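(* For every fixed integer $s\ge2$, there exist an integer $\kappa_s\in\{s,\ldots,2s\}$, a constant $C_s>0$, and an integer $p_s$ such that, for all integers $p\ge p_s$ and $q$ with $C_s\log(ep)\le q\le p$, $$\mathrm{HD}_1^{(s)}(p,q)\in\{p-q+\kappa_s,\;p-q+\kappa_s+1\}.$$ Moreover, the sequence $\bigl(\mathrm{HD}_1^{(s)}(t,t)\bigr)_{t\ge2}$ is nonincreasing, and $\kappa_s$ is its eventual constant value.
   Context: A set in $\mathbb{R}$ is called $s$-convex (an $s$-interval) if it is the union of at most $s$ convex sets (intervals); since only finite families are considered, one may equivalently take the intervals to be compact. For positive integers $p\ge q$, a family $\mathcal F$ of (distinct) sets with at least $p$ members satisfies the $(p,q)$-property if among every $p$ members of $\mathcal F$ some $q$ have a nonempty common intersection. A transversal (piercing set) of $\mathcal F$ is a set of points meeting every member of $\mathcal F$, and $\tau(\mathcal F)$ is the minimum size of a transversal. For $p\ge q\ge 2$, $\mathrm{HD}_1^{(s)}(p,q)$ denotes the least integer $N$ such that $\tau(\mathcal F)\le N$ for every finite family $\mathcal F$ of nonempty $s$-convex sets in $\mathbb{R}$ satisfying the $(p,q)$-property. Here $e$ is the base of the natural logarithm $\log$. *)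

(* Defs.v *)
From mathcomp Require Import all_boot all_order all_algebra finmap.
From mathcomp Require Import boolp classical_sets reals exp convex.
Set Implicit Arguments.
Unset Strict Implicit.
Unset Printing Implicit Defensive.
Import Order.TTheory GRing.Theory Num.Theory.

Local Open Scope classical_set_scope.
Local Open Scope fset_scope.

Definition is_minimum (P : set nat) (n : nat) : Prop := P n /\ lbound P n.

Section PqProblem.
Variable R : realType.

(* [R^o] is [R] as a vector space over itself, the ambient space R^1. *)
Definition s_convex (s : nat) (A : set R) : Prop :=
  exists2 k : nat, (k <= s)%N &
  exists I : 'I_k -> set R,
    (forall i, convex_set (I i : set R^o)) /\ A = \bigcup_i I i.

(* Families are finite sets of sets, so their members are distinct. *)
Definition pq_property (p q : nat) (F : {fset (set R)}) : Prop :=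
  (p <= #|` F|)%N /\
  forall P : {fset (set R)}, P `<=` F -> #|` P| = p ->
    exists Q : {fset (set R)}, [/\ Q `<=` P, #|` Q| = q &
      exists x : R, forall A : set R, A \in Q -> A x].

(* Minimum transversals of finite families are finite, so [X] is a finite set. *)
Definition pierces (X : {fset R}) (F : {fset (set R)}) : Prop :=
  forall A : set R, A \in F -> exists2 x, x \in X & A x.

Definition is_tau (F : {fset (set R)}) (t : nat) : Prop :=
  is_minimum [set n | exists2 X, pierces X F & #|` X| = n] t.

Definition HD_bound (s p q N : nat) : Prop :=
  forall F : {fset (set R)},
    (forall A : set R, A \in F -> A !=set0 /\ s_convex s A) -> pq_property p q F ->
    exists2 t, is_tau F t & (t <= N)%N.

Definition is_HD (s p q N : nat) : Prop := is_minimum (HD_bound s p q) N.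

End PqProblem.

(* Main.v *)
(* Counting intersecting [t]-tuples of weighted members, each charged to a left endpoint, shows
   that every weighting has a point contained in members of large relative weight. Reweighting
   turns this into finitely many points, with multiplicity, densely met by each member, and the
   quantiles of these points form a small transversal. If every [t] members intersect, with [t]
   large, the density exceeds s / (s + 1) and [s] points suffice, so kappa = s. If at most nu
   members are pairwise disjoint, O(nu) points suffice.

   For the (p, q)-property, put k = p - q and repeatedly remove a large family of pairwise
   disjoint members. If [S] is what has been removed and every point misses at least [f] members
   of [S], with equality at some point, then [f + 1] points pierce [S], while the rest inherits
   the property with p - #|S| and k - f. After O(log p) rounds k - f is bounded; then k - f
   members can be discarded so that every [t] of the remaining ones intersect. The single extra
   point is paid for [S]. For the lower bounds, add p - q isolated points to the family of the
   unions of all but s - 1 of many consecutive unit cells. *)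
Require Import Defs.
From mathcomp Require Import all_boot all_order all_algebra.
From mathcomp Require Import boolp reals sequences exp.
From mathcomp Require Import zify lra ring.
Set Implicit Arguments.
Unset Strict Implicit.
Unset Printing Implicit Defensive.
Import Order.TTheory GRing.Theory Num.Theory.
Local Open Scope ring_scope.

Lemma functional_choice (X Y : Type) (P : X -> Y -> Prop) :
  (forall x, exists y, P x y) -> exists f, forall x, P x (f x).
Proof. by move=> /choice[f fP]; exists f. Qed.

Lemma bernoulli (R : realFieldType) (a : R) n : 0 <= a -> 1 + n%:R * a <= (1 + a) ^+ n.
Proof.
move=> a0; elim: n => [|n IH]; first by rewrite mul0r addr0 expr0.
rewrite exprS -natr1; have n0 : 0 <= n%:R :> R by [].
by apply: le_trans (ler_wpM2l _ IH); [nra | lra].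
Qed.

Lemma exists_expr_lt (R : realType) (y e : R) : 0 <= y < 1 -> 0 < e ->
  exists n, y ^+ n < e.
Proof.
case/andP; rewrite le_eqVlt => /predU1P[<- _ e0|y0 y1 e0].
  by exists 1%N; rewrite expr1.
have yV1 : 1 < y^-1 by rewrite invf_gt1.
have d0 : 0 < y^-1 - 1 by rewrite subr_gt0.
have := archi_boundP (ltW (divr_gt0 (ltr0Sn R 0) (mulr_gt0 e0 d0))).
set n := Num.bound _ => hn; exists n.
rewrite -[e]invrK -[y ^+ n]invrK ltf_pV2 ?posrE ?invr_gt0 ?exprn_gt0 // -exprVn.
have := bernoulli n (ltW d0); rewrite addrCA subrr addr0; apply: lt_le_trans.
rewrite invfM mul1r -ltr_pdivlMr ?invr_gt0 // invrK in hn.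
by move: hn; lra.
Qed.

Section IndexedFamily.
Variables (R : realType) (I : finType) (s : nat) (J : I -> 'I_s -> R -> bool).
Hypothesis Jconvex : forall i c x y z, J i c x -> J i c z -> x <= y <= z -> J i c y.

Definition hit (i : I) (x : R) := [exists c, J i c x].

Definition pierced (V : {set I}) (n : nat) :=
  exists2 X : seq R, (size X <= n)%N & forall i, i \in V -> has (hit i) X.

(* Take every g-th point of [ys]: some component of a member contains more than [g] points of
   [ys], hence spans a multiple of g. *)
Lemma pierced_of_count (V : {set I}) (ys : seq R) (N g : nat) :
  size ys = (N * g)%N -> (forall i, i \in V -> s * g < count (hit i) ys)%N ->
  pierced V N.-1.
Proof.
move=> sz H.
pose zs := sort <=%R ys.
have szz : size zs = (N * g)%N by rewrite size_sort.
have srt : sorted <=%R zs by apply: sort_sorted; exact: le_total.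
exists [seq nth 0 zs (k.+1 * g) | k <- iota 0 N.-1]; first by rewrite size_map size_iota.
move=> i iV; have {}H : (s * g < count (hit i) zs)%N by rewrite count_sort; apply: H.
have [c Hc] : exists c, (g < count (J i c) zs)%N.
  apply/existsP; apply: contraTT H => /existsPn H; rewrite -leqNgt.
  apply: (@leq_trans (\sum_(c < s) count (J i c) zs)); last first.
    apply: (@leq_trans (\sum_(c < s) g)); first by apply: leq_sum => c _; rewrite leqNgt.
    by rewrite sum_nat_const card_ord.
  rewrite -sum1_count big_mkcond /=.
  under [X in (_ <= X)%N]eq_bigr do rewrite -sum1_count big_mkcond /=.
  rewrite exchange_big /=; apply: leq_sum => x _.
  case: ifP => // /existsP[c Jc]; rewrite (bigD1 c) //= Jc //.
pose a := J i c; pose u := find a zs.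
have g0 : (0 < g)%N.
  by case: (posnP g) => // g0; rewrite g0 muln0 in szz; rewrite (size0nil szz) in Hc.
have hasa : has a zs by rewrite has_count; apply: leq_trans Hc.
have hv : has a (drop (u + g) zs).
  rewrite has_count -(ltn_add2l g) addn0; apply: leq_trans Hc _.
  rewrite -[in X in (X <= _)%N](cat_take_drop (u + g) zs) count_cat leq_add2r.
  rewrite takeD count_cat -[X in (_ <= X)%N]add0n leq_add //.
    rewrite leqn0 -/(@count _ _ _) eqn0Ngt -has_count; apply/negP=> /(has_nthP 0)[k].
    rewrite size_take_min leq_min => /andP[ku _]; rewrite nth_take //.
    by rewrite -/a (before_find 0 ku).
  by apply: leq_trans (count_size _ _) _; rewrite size_take_min geq_minl.
have /(has_nthP 0)[k] := hv; rewrite size_drop nth_drop => ksz av.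
have vsz : (u + g + k < N * g)%N by rewrite -szz -ltn_subRL.
apply/hasP; exists (nth 0 zs ((u %/ g).+1 * g)).
  apply/mapP; exists (u %/ g)%N => //; rewrite mem_iota add0n /=.
  have : ((u %/ g).+1 * g < N * g)%N.
    apply: leq_ltn_trans vsz; rewrite mulSn addnC -addnA leq_add ?leq_divM // leq_addr //.
  by rewrite ltn_pmul2r //; case: (N).
have kv : ((u %/ g).+1 * g <= u + g + k)%N.
  by rewrite mulSn addnC -addnA leq_add ?leq_divM ?leq_addr.
apply/existsP; exists c; apply: (Jconvex (nth_find 0 hasa) av).
have lt v : (v <= u + g + k)%N -> v \in gtn (size zs).
  by move=> hle; rewrite inE szz; apply: leq_ltn_trans vsz.
have lenth := sorted_leq_nth (@le_trans _ R) (@lexx _ R) 0 srt.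
apply/andP; split; apply: lenth => //; rewrite ?lt //; first by rewrite -addnA leq_addr.
by apply: ltnW; rewrite ltn_ceil.
Qed.

(* Multiplicative weights: halve the weight of the members hit by a point of maximal depth. *)
Lemma multiplicative_weights (V : {set I}) (b : R) : b <= 2 ->
  (forall w : I -> R, (forall i, 0 <= w i) ->
     exists x, b * (\sum_(i in V) w i) <= \sum_(i in V | hit i x) w i) ->
  forall n, exists2 ys : seq R, size ys = n &
    \sum_(i in V) 2^-1 ^+ count (hit i) ys <= #|V|%:R * (1 - b / 2) ^+ n.
Proof.
move=> b2 H; elim=> [|n [ys sz IH]].
  by exists [::] => //; rewrite expr0 mulr1; under eq_bigr do rewrite expr0; rewrite sumr_const.
have [i|x hx] := H (fun i => 2^-1 ^+ count (hit i) ys); first by rewrite exprn_ge0 ?invr_ge0.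
exists (x :: ys); first by rewrite /= sz.
rewrite exprSr mulrA.
apply: le_trans (ler_wpM2r _ IH); last by lra.
have -> : \sum_(i in V) (2^-1 : R) ^+ count (hit i) (x :: ys) =
  (\sum_(i in V) (2^-1 : R) ^+ count (hit i) ys) -
  2^-1 * \sum_(i in V | hit i x) 2^-1 ^+ count (hit i) ys.
  rewrite mulr_sumr big_mkcondr -sumrB /=; apply: eq_bigr => i _.
  by case: ifP => _; rewrite ?add0n ?subr0 // add1n exprS; lra.
by move: hx; lra.
Qed.

Lemma pierced_of_depth (V : {set I}) (b : R) (N : nat) : b <= 2 ->
  2 ^+ s * (1 - b / 2) ^+ N < 1 ->
  (forall w : I -> R, (forall i, 0 <= w i) ->
     exists x, b * (\sum_(i in V) w i) <= \sum_(i in V | hit i x) w i) ->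
  pierced V N.-1.
Proof.
move=> b2 hN H; set y := 2 ^+ s * _ in hN.
have x0 : 0 <= 1 - b / 2 by lra.
have y0 : 0 <= y by rewrite mulr_ge0 ?exprn_ge0.
have [||g hg] := @exists_expr_lt R y (#|V|.+1%:R^-1); first by rewrite y0 hN.
  by rewrite invr_gt0.
have [ys sz hys] := multiplicative_weights b2 H (N * g).
apply: (pierced_of_count sz) => i iV; rewrite ltnNge; apply/negP=> hle.
have : (2^-1 : R) ^+ (s * g) <= #|V|%:R * (1 - b / 2) ^+ (N * g).
  apply: le_trans hys; rewrite (bigD1 i) //=; apply: le_trans (_ : _ <= 2^-1 ^+ count (hit i) ys) _.
    by apply: ler_wiXn2l => //; lra.
  by rewrite lerDl; apply: sumr_ge0 => k _; rewrite exprn_ge0 ?invr_ge0.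
rewrite exprVn -[_^-1]mulr1 ler_pdivrMl ?exprn_gt0 //.
rewrite mulrCA exprM [X in _ * (_ * X)]exprM -exprMn -/y.
apply/negP; rewrite -ltNge.
move: hg; rewrite -[_^-1]mul1r ltr_pdivlMr // mulrC; apply: le_lt_trans.
by rewrite ler_wpM2r ?exprn_ge0 // ler_nat.
Qed.

(* An intersecting tuple is charged to the largest left endpoint among the components
   containing a common point; that endpoint is again a common point. *)
Lemma sum_intersecting_tuples (V : {set I}) (n : nat) (T : {set {ffun 'I_n.+1 -> I}})
    (w : I -> R) (D : R) :
  (forall i, 0 <= w i) -> (forall x, \sum_(i in V | hit i x) w i <= D) ->
  (forall f, f \in T -> forall j, f j \in V) ->
  (forall f, f \in T -> exists x, forall j, hit (f j) x) ->
  \sum_(f in T) \prod_j w (f j) <= (n.+1 * s)%:R * (\sum_(i in V) w i) * D ^+ n.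
Proof.
move=> w0 hD TV Tx.
have [y yP] : exists y : {ffun 'I_n.+1 -> I} -> R, forall f, f \in T -> forall j, hit (f j) (y f).
  apply: (@functional_choice _ _ (fun f x => f \in T -> forall j, hit (f j) x)) => f.
  have [/Tx[x hx]|] := boolP (f \in T); first by exists x.
  by exists 0.
have [l lP] : exists l : I * 'I_s -> R, forall ic f, f \in T -> J ic.1 ic.2 (y f) ->
    J ic.1 ic.2 (l ic) /\ l ic <= y f.
  apply: (@functional_choice _ _ (fun ic x => forall f, f \in T -> J ic.1 ic.2 (y f) ->
    J ic.1 ic.2 x /\ x <= y f)) => -[i c] /=.
  have [/existsP[f0 h0]|/existsPn h] := boolP [exists f, (f \in T) && J i c (y f)]; last first.
    by exists 0 => f fT Jf; have := h f; rewrite fT Jf.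
  case: (@Order.TotalTheory.arg_minP _ _ _ f0 (fun f => (f \in T) && J i c (y f)) y h0) =>
    f1 /andP[f1T J1] hmin.
  by exists (y f1) => f fT Jf; split=> //; apply: hmin; rewrite fT.
have key f : f \in T -> exists jc : 'I_n.+1 * 'I_s, forall j', hit (f j') (l (f jc.1, jc.2)).
  move=> fT; have [cc ccP] : exists cc : 'I_n.+1 -> 'I_s, forall j, J (f j) (cc j) (y f).
    by apply: (@functional_choice _ _ (fun j c => J (f j) c (y f))) => j; apply/existsP; apply: yP.
  case: (@Order.TotalTheory.arg_maxP _ _ _ (ord0 : 'I_n.+1) xpredT
    (fun j => l (f j, cc j))) => // j _ hj.
  exists (j, cc j) => j' /=; apply/existsP; exists (cc j').
  have [J1 _] := lP (f j', cc j') f fT (ccP j').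
  have [_ l2] := lP (f j, cc j) f fT (ccP j).
  by apply: Jconvex J1 (ccP j') _; rewrite l2 andbT; apply: hj.
pose G (f : {ffun 'I_n.+1 -> I}) := \prod_j w (f j).
have G0 f : 0 <= G f by apply: prodr_ge0.
pose P (jc : 'I_n.+1 * 'I_s) (f : {ffun 'I_n.+1 -> I}) :=
  [forall j', (f j' \in V) && hit (f j') (l (f jc.1, jc.2))].
apply: (@le_trans _ _ (\sum_(jc : 'I_n.+1 * 'I_s) \sum_(f | P jc f) G f)).
  under [X in _ <= X]eq_bigr do rewrite big_mkcond /=.
  rewrite exchange_big /= big_mkcond; apply: ler_sum => f _.
  case: ifP => [fT|_]; last by apply: sumr_ge0 => jc _; case: ifP.
  have [jc hjc] := key f fT.
  rewrite (bigD1 jc) //= ifT ?lerDl; first by apply: sumr_ge0 => ? _; case: ifP.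
  by apply/forallP=> j'; rewrite (TV f fT) hjc.
have D0 : 0 <= D by apply: le_trans (hD 0); apply: sumr_ge0.
have main jc : \sum_(f | P jc f) G f <= (\sum_(i in V) w i) * D ^+ n.
  case: jc => j c; rewrite (partition_big (fun f : {ffun _ -> _} => f j) (mem V)) /=; last first.
    by move=> f /forallP/(_ j)/andP[].
  rewrite mulr_suml; apply: ler_sum => i iV.
  pose Q (j' : 'I_n.+1) : pred I :=
    if j' == j then pred1 i else [pred i' | (i' \in V) && hit i' (l (i, c))].
  apply: (@le_trans _ _ (\sum_(f in family Q) G f)).
    rewrite big_mkcond [X in _ <= X]big_mkcond /=; apply: ler_sum => f _.
    case: ifP => [/andP[/forallP /= h /eqP fj]|_]; last by case: ifP.
    rewrite ifT //; apply/familyP => j'; rewrite /Q; case: eqP => [->|_]; first by rewrite inE fj.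
    by have := h j'; rewrite fj inE.
  rewrite -(bigA_distr_big_dep _ (fun _ i => w i)) (bigD1 j) //= /Q eqxx big_pred1_eq.
  rewrite ler_wpM2l //.
  rewrite (_ : D ^+ n = \prod_(j' < n.+1 | j' != j) D); last first.
    by rewrite prodr_const cardC1 card_ord.
  apply: ler_prod => j' /negbTE ->; rewrite sumr_ge0 //=; exact: (hD (l (i, c))).
apply: le_trans (ler_sum _ (fun jc _ => main jc)) _.
by rewrite sumr_const card_prod !card_ord -mulrA mulr_natl.
Qed.

End IndexedFamily.

Lemma weighted_turan (R : realFieldType) (I : finType) (r : rel I) (w : I -> R) (nu : nat)
    (V : {set I}) :
  reflexive r -> symmetric r -> (forall i, 0 <= w i) ->
  (forall S : {set I}, S \subset V -> {in S &, forall i j, r i j -> i = j} -> #|S| <= nu)%N ->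
  (\sum_(i in V) w i) ^+ 2 <= nu%:R * \sum_(i in V) \sum_(j in V | r i j) w i * w j.
Proof.
move=> rr rs w0; elim: nu V => [|nu IH] V HV.
  have -> : V = set0.
    apply/eqP; apply/set0Pn => -[i iV]; have : (#|[set i]| <= 0)%N.
      by apply: HV => [|? ? /set1P-> /set1P->]; rewrite ?sub1set.
    by rewrite cards1.
  by rewrite !big_set0 expr0n mul0r.
have [->|[i0 i0V]] := set_0Vmem V; first by rewrite !big_set0 expr0n mulr0.
pose d i := \sum_(j in V | r i j) w j.
case: (@Order.TotalTheory.arg_minP _ _ _ i0 (mem V) d i0V) => i iV' dmin.
have {iV'}iV : i \in V := iV'.
pose V' := [set j in V | ~~ r i j].
have V'V : V' \subset V by apply/subsetP => j; rewrite inE => /andP[].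
have splitV (F : I -> R) : \sum_(j in V) F j = \sum_(j in V | r i j) F j + \sum_(j in V') F j.
  by rewrite (bigID (r i)) /=; congr (_ + _); apply: eq_bigl => j; rewrite inE.
set Q := \sum_(i in V) _ in |- *; rewrite splitV -/(d i).
set b := \sum_(j in V') _; pose Q' := \sum_(i in V') \sum_(j in V' | r i j) w i * w j.
have b0 : 0 <= b by apply: sumr_ge0.
have d0 : 0 <= d i by apply: sumr_ge0.
have Q'0 : 0 <= Q' by apply: sumr_ge0 => k _; apply: sumr_ge0 => j _; apply: mulr_ge0.
have hQ : d i ^+ 2 + Q' <= Q.
  rewrite /Q splitV lerD //.
    rewrite expr2 {1}/d mulr_suml; apply: ler_sum => j /andP[jV rij].
    by rewrite -mulr_sumr ler_wpM2l // -/(d j) dmin.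
  apply: ler_sum => j _; rewrite big_mkcond [X in _ <= X]big_mkcond /=; apply: ler_sum => k _.
  case: ifP => [/andP[kV' rjk]|_]; last by case: ifP => // _; apply: mulr_ge0.
  by rewrite rjk (subsetP V'V).
apply: (@le_trans _ _ (nu.+1%:R * (d i ^+ 2 + Q'))); last by rewrite ler_wpM2l.
have {}IH : b ^+ 2 <= nu%:R * Q'.
  apply: IH => S SV' Sind; rewrite -ltnS.
  have iS : i \notin S by apply/negP => /(subsetP SV'); rewrite inE rr andbF.
  have -> : #|S|.+1 = #|i |: S| by rewrite cardsU1 iS.
  apply: HV; first by rewrite subUset sub1set iV (subset_trans SV').
  have nr j : j \in S -> r i j = false.
    by move=> /(subsetP SV'); rewrite inE => /andP[_ /negbTE].
  move=> j k /setU1P[->|jS] /setU1P[->|kS] //; first by rewrite nr.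
    by rewrite rs nr.
  exact: Sind.
case: nu IH {HV} => [|nu]; first by rewrite mul0r => IH; nra.
move=> IH; set n : R := nu.+1%:R in IH *.
have n0 : 0 < n by rewrite ltr0n.
rewrite -natr1 -/n.
rewrite -(ler_pM2l n0).
have : 0 <= (n * d i - b) ^+ 2 by apply: sqr_ge0.
have := ler_wpM2l (ltW n0) IH.
nra.
Qed.

Lemma exprB1_le_half (R : realFieldType) (m : nat) : (0 < m)%N ->
  (1 - m%:R^-1 : R) ^+ m <= 2^-1.
Proof.
move=> m0; have m0R : 0 < m%:R :> R by rewrite ltr0n.
have v0 : 0 < m%:R^-1 :> R by rewrite invr_gt0.
have v1 : m%:R^-1 <= 1 :> R by rewrite invf_le1 // ler1n.
have := bernoulli m (ltW v0); rewrite mulfV ?gt_eqF // => h2.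
have : ((1 - m%:R^-1) * (1 + m%:R^-1)) ^+ m <= 1 :> R.
  by apply: exprn_ile1; nra.
rewrite exprMn => h1.
have x0 : 0 <= (1 - m%:R^-1 : R) ^+ m by apply: exprn_ge0; lra.
have := ler_wpM2l x0 h2; lra.
Qed.

Lemma expr1D_le (R : realFieldType) (e : R) (n : nat) : 0 <= e <= 1 ->
  (1 + e) ^+ n <= 1 + (2 ^+ n - 1) * e.
Proof.
case/andP=> e0 e1; elim: n => [|n IH]; first by rewrite !expr0; lra.
have p1 : 1 <= 2 ^+ n :> R by rewrite exprn_ege1 // ler1n.
rewrite !exprS; apply: le_trans (ler_wpM2l _ IH) _; first lra.
have : 0 <= (2 ^+ n - 1) * (e * (1 - e)) by rewrite !mulr_ge0 // subr_ge0.
lra.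
Qed.

Section PiercingBounds.
Variables (R : realType) (I : finType) (s : nat) (J : I -> 'I_s -> R -> bool).
Hypothesis Jconvex : forall i c x y z, J i c x -> J i c z -> x <= y <= z -> J i c y.
Hypothesis s_gt0 : (0 < s)%N.
Hypothesis hit_ex : forall i, exists x, hit J i x.
Local Notation hit := (hit J).
Local Notation pierced := (pierced J).

Definition meet : rel I := fun i j => `[< exists x, hit i x && hit j x >].

Definition disjoint_members (S : {set I}) := {in S &, forall i j, meet i j -> i = j}.

Lemma pierced_of_matching (V : {set I}) (nu : nat) :
  (forall S : {set I}, S \subset V -> disjoint_members S -> #|S| <= nu)%N ->
  pierced V (8 * s * s.+1 * nu)%N.
Proof.
move=> HV; have [nu0|nu_gt0] := posnP nu.
  exists [::] => // i iV; have : (#|[set i]| <= nu)%N.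
    by apply: HV => [|? ? /set1P-> /set1P->]; rewrite ?sub1set.
  by rewrite cards1 nu0.
pose m := (8 * s * nu)%N; have m0 : (0 < m)%N by rewrite !muln_gt0 s_gt0.
have [X hX XP] : pierced V (m * s.+1).-1; last first.
  exists X => //; apply: leq_trans hX _; rewrite /m mulnAC; exact: leq_pred.
have m0R : 0 < m%:R :> R by rewrite ltr0n.
have v0 : 0 < m%:R^-1 :> R by rewrite invr_gt0.
have v1 : m%:R^-1 <= 1 :> R by rewrite invf_le1 // ler1n.
apply: (pierced_of_depth (N := (m * s.+1)%N) (b := 2 * m%:R^-1) Jconvex); first lra.
  rewrite (_ : 2 * m%:R^-1 / 2 = m%:R^-1) ?[_ ^+ (m * _)]exprM; last lra.
  apply: (@le_lt_trans _ _ (2 ^+ s * 2^-1 ^+ s.+1)).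
    rewrite ler_wpM2l ?exprn_ge0 // ler_pXn2r ?nnegrE ?exprn_ge0 ?invr_ge0 //; last lra.
    exact: exprB1_le_half.
  rewrite exprS mulrCA -exprMn mulfV ?pnatr_eq0 // expr1n; lra.
move=> w w0; set W := \sum_(i in V) w i; apply: contrapT => hn.
have {}hn x : \sum_(i in V | hit i x) w i < 2 * m%:R^-1 * W.
  by rewrite ltNge; apply/negP => h; apply: hn; exists x.
have W0 : 0 < W.
  have : 0 < 2 * m%:R^-1 * W by apply: le_lt_trans (hn 0); apply: sumr_ge0.
  by rewrite pmulr_rgt0 // mulr_gt0.
pose T := [set f : {ffun 'I_2 -> I} |
  [&& f ord0 \in V, f ord_max \in V & meet (f ord0) (f ord_max)]].
have hT := @sum_intersecting_tuples R I s J Jconvex V 1 T w (2 * m%:R^-1 * W) w0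
  (fun x => ltW (hn x)).
have ord2 (j : 'I_2) : j = ord0 \/ j = ord_max.
  by case: j => -[|[|//]] h; [left | right]; apply: val_inj.
have {}hT : \sum_(f in T) \prod_j w (f j) <= (2 * s)%:R * W * (2 * m%:R^-1 * W).
  apply: hT => [f|f]; rewrite inE => /and3P[h0 h1 h2].
    by move=> j; case: (ord2 j) => ->.
  by have /asboolP[x /andP[x0 x1]] := h2; exists x => j; case: (ord2 j) => ->.
have refl_meet : reflexive meet.
  by move=> i; apply/asboolP; have [x hx] := hit_ex i; exists x; rewrite hx.
have sym_meet : symmetric meet.
  by move=> i j; apply/asboolP/asboolP => -[x]; rewrite andbC; exists x.
have := weighted_turan refl_meet sym_meet w0 HV; rewrite -/W.
rewrite pair_big_dep /=.
pose h (p : I * I) : {ffun 'I_2 -> I} := [ffun k => if k == ord0 then p.1 else p.2].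
have -> : \sum_(p | (p.1 \in V) && ((p.2 \in V) && meet p.1 p.2)) w p.1 * w p.2 =
    \sum_(f in T) \prod_j w (f j).
  rewrite (reindex h) /=.
    apply: eq_big => p; first by rewrite inE !ffunE.
    by rewrite big_ord_recl big_ord1 !ffunE.
  exists (fun f : {ffun 'I_2 -> I} => (f ord0, f ord_max)).
    by move=> [i j] _; rewrite /h !ffunE.
  by move=> f _; apply/ffunP => j; rewrite ffunE; case: (ord2 j) => ->.
move=> hW; have := le_trans hW (ler_wpM2l (ler0n R nu) hT).
have -> : nu%:R * ((2 * s)%:R * W * (2 * m%:R^-1 * W)) = W ^+ 2 / 2.
  have -> : m%:R = 8 * s%:R * nu%:R :> R by rewrite !natrM.
  rewrite natrM; field; rewrite !pnatr_eq0 -!lt0n s_gt0 nu_gt0 //.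
have : 0 < W ^+ 2 by rewrite exprn_gt0.
by move=> *; lra.
Qed.

Definition wise_intersecting (t : nat) (V : {set I}) :=
  forall W : {set I}, W \subset V -> (#|W| <= t)%N ->
    exists x, forall i, i \in W -> hit i x.

Lemma wise_intersecting_depth (n : nat) (b : R) (V : {set I}) : 0 < b ->
  (n.+1 * s)%:R * b ^+ n < 1 -> wise_intersecting n.+1 V ->
  forall w : I -> R, (forall i, 0 <= w i) ->
    exists x, b * (\sum_(i in V) w i) <= \sum_(i in V | hit i x) w i.
Proof.
move=> b0 hb HV w w0; set W := \sum_(i in V) w i; apply: contrapT => hn.
have {}hn x : \sum_(i in V | hit i x) w i < b * W.
  by rewrite ltNge; apply/negP => h; apply: hn; exists x.
have W0 : 0 < W.
  have : 0 < b * W by apply: le_lt_trans (hn 0); apply: sumr_ge0.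
  by rewrite pmulr_rgt0.
pose T := [set f : {ffun 'I_n.+1 -> I} | f \in ffun_on (mem V)].
have := @sum_intersecting_tuples R I s J Jconvex V n T w (b * W) w0 (fun x => ltW (hn x)).
have hTV f : f \in T -> forall j, f j \in V by rewrite inE => /ffun_onP.
have hTx f : f \in T -> exists x, forall j, hit (f j) x.
  move=> fT; have [||x hx] := HV (f @: setT).
  - by apply/subsetP => _ /imsetP[j _ ->]; apply: hTV.
  - by apply: leq_trans (leq_imset_card _ _) _; rewrite cardsT card_ord.
  by exists x => j; apply: hx; apply: imset_f.
move=> /(_ hTV hTx).
have -> : \sum_(f in T) \prod_j w (f j) = W ^+ n.+1.
  have <- : \prod_(j < n.+1) W = W ^+ n.+1 by rewrite prodr_const card_ord.
  rewrite bigA_distr_big.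
  by apply: eq_bigl => f; rewrite inE.
rewrite exprMn exprS mulrACA -[X in X <= _]mul1r ler_pM2r ?mulr_gt0 ?exprn_gt0 //.
by rewrite leNgt hb.
Qed.

Lemma pierced_of_wise_intersecting (n : nat) (V : {set I}) :
  (n.+1 * s)%:R * (1 - (2 ^ s.+1)%:R^-1) ^+ n < 1 :> R ->
  wise_intersecting n.+1 V -> pierced V s.
Proof.
move=> hn HV; set e : R := _^-1 in hn.
have e0 : 0 < e by rewrite invr_gt0 ltr0n expn_gt0.
have e1 : e < 1 by rewrite invf_lt1 ?ltr0n ?expn_gt0 // ltr1n -{1}(expn0 2) ltn_exp2l.
apply: (pierced_of_depth (N := s.+1) (b := 1 - e) Jconvex); first lra; last first.
  by apply: wise_intersecting_depth hn HV; lra.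
have -> : 1 - (1 - e) / 2 = (1 + e) / 2 by lra.
have := @expr1D_le R e s.+1; rewrite (ltW e0) (ltW e1) => /(_ isT).
rewrite mulrBl -natrX mulfV ?pnatr_eq0 -?lt0n ?expn_gt0 // mul1r => h.
have A0 : 2 ^+ s != 0 :> R by rewrite expf_neq0 ?pnatr_eq0.
have -> : 2 ^+ s * ((1 + e) / 2) ^+ s.+1 = (1 + e) ^+ s.+1 / 2.
  by rewrite expr_div_n [2 ^+ s.+1]exprS; field.
lra.
Qed.

End PiercingBounds.

Lemma leq_card_bigcup (I T : finType) (n : nat) (A : {set I}) (B : I -> {set T}) :
  (forall i, i \in A -> #|B i| <= n)%N -> (#|\bigcup_(i in A) B i| <= #|A| * n)%N.
Proof.
move=> h; rewrite -sum_nat_const; elim/big_rec2: _ => [|i x y iA IH]; first by rewrite cards0.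
apply: leq_trans (leq_card_setU _ _) _; rewrite leq_add ?h //.
Qed.

Fixpoint cover_size (t k : nat) : nat :=
  if k is k'.+1 then (t + t * cover_size t k')%N else t.

Lemma leq_cover_size (t : nat) : (0 < t)%N -> {homo cover_size t : k l / (k <= l)%N}.
Proof.
move=> t0; apply: homo_leq => [//|y x z|k /=]; first exact: leq_trans.
by apply: leq_trans (leq_addl _ _); rewrite leq_pmull.
Qed.

Lemma cover_size_gt0 (t k : nat) : (0 < t)%N -> (0 < cover_size t k)%N.
Proof. by move=> t0; apply: leq_trans t0 (leq_cover_size t0 (leq0n k)). Qed.

Section Peeling.
Variables (R : realType) (I : finType) (s : nat) (J : I -> 'I_s -> R -> bool).
Hypothesis Jconvex : forall i c x y z, J i c x -> J i c z -> x <= y <= z -> J i c y.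
Hypothesis s_gt0 : (0 < s)%N.
Hypothesis hit_ex : forall i, exists x, hit J i x.
Local Notation hit := (hit J).
Local Notation pierced := (pierced J).
Local Notation wise_intersecting := (wise_intersecting J).

Definition miss (W : {set I}) (x : R) := #|[set i in W | ~~ hit i x]|.

Definition deficiency_le (V : {set I}) (p k : nat) :=
  forall W : {set I}, W \subset V -> (#|W| <= p)%N -> exists x, (miss W x <= k)%N.

Lemma miss_subset (W W' : {set I}) (x : R) : W \subset W' -> (miss W x <= miss W' x)%N.
Proof.
move=> sW; apply/subset_leq_card/subsetP => i; rewrite !inE => /andP[iW ->].
by rewrite (subsetP sW).
Qed.

Lemma missU (A B : {set I}) (x : R) : [disjoint A & B] ->
  miss (A :|: B) x = (miss A x + miss B x)%N.
Proof.
move=> dAB; have d : [disjoint [set i in A | ~~ hit i x] & [set i in B | ~~ hit i x]].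
  by apply: disjointW dAB; apply/subsetP => i; rewrite inE => /andP[].
rewrite /miss -cardsUI (disjoint_setI0 d) cards0 addn0.
by apply: eq_card => i; rewrite !inE andb_orl.
Qed.

Lemma miss_disjoint_members (S : {set I}) (x : R) : disjoint_members J S ->
  (#|S| <= (miss S x).+1)%N.
Proof.
move=> dS; rewrite -(cardsID [set i | hit i x] S) -addn1 addnC; apply: leq_add.
  by apply/subset_leq_card/subsetP => i; rewrite !inE andbC.
apply/card_le1_eqP => i j; rewrite !inE => /andP[iS ix] /andP[jS jx].
by apply: dS => //; apply/asboolP; exists x; rewrite ix jx.
Qed.

Lemma exists_min_miss (S : {set I}) :
  exists f, (exists x, miss S x = f) /\ forall x, (f <= miss S x)%N.
Proof.
have ex : exists n, `[< exists x, miss S x = n >] by exists (miss S 0); apply/asboolP; exists 0.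
exists (ex_minn ex); case: ex_minnP => n /asboolP nP hmin; split=> // x.
by apply: hmin; apply/asboolP; exists x.
Qed.

Lemma pierced_leq (V : {set I}) (m n : nat) : (m <= n)%N -> pierced V m -> pierced V n.
Proof. by move=> mn [X hX XV]; exists X => //; apply: leq_trans mn. Qed.

Lemma piercedU (A B V : {set I}) (m n : nat) : V \subset A :|: B ->
  pierced A m -> pierced B n -> pierced V (m + n)%N.
Proof.
move=> sV [X hX XA] [Y hY YB]; exists (X ++ Y); first by rewrite size_cat leq_add.
move=> i /(subsetP sV) /setUP[/XA|/YB] h; rewrite has_cat h ?orbT //.
Qed.

Lemma pierced_card (V : {set I}) : pierced V #|V|.
Proof.
have [y yP] := functional_choice hit_ex.
exists [seq y i | i <- enum V]; first by rewrite size_map -cardE.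
by move=> i iV; apply/hasP; exists (y i) => //; apply: map_f; rewrite mem_enum.
Qed.

Lemma pierced_miss (S : {set I}) (x : R) : pierced S (miss S x).+1.
Proof.
rewrite -addn1; apply: (@piercedU [set i in S | ~~ hit i x] [set i in S | hit i x]).
- by apply/subsetP => i iS; rewrite !inE iS; case: hit.
- exact: pierced_card.
by exists [:: x] => // i; rewrite inE => /andP[_ /= ->].
Qed.

Lemma deficiency_le_setD (V S : {set I}) (p k f : nat) :
  deficiency_le V p k -> S \subset V -> (#|S| <= p)%N -> (forall x, f <= miss S x)%N ->
  deficiency_le (V :\: S) (p - #|S|) (k - f).
Proof.
move=> dV SV Sp hf W /subsetDP[WV dWS] Wp.
have [||x] := dV (S :|: W); first by rewrite subUset SV.
  by apply: leq_trans (leq_card_setU _ _) _; rewrite -leq_subRL // (leq_trans Wp).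
rewrite missU 1?disjoint_sym // => h; exists x.
by have := hf x; lia.
Qed.

(* Branch on the at most [t] members of a tuple without common point. *)
Lemma wise_intersecting_or_deficient (t k : nat) (V : {set I}) :
  (exists2 K : {set I}, (#|K| <= k)%N & wise_intersecting t (V :\: K)) \/
  (exists W : {set I}, [/\ W \subset V, (#|W| <= cover_size t k)%N & forall x, k < miss W x]%N).
Proof.
elim: k V => [|k IH] V.
  have [h|/existsNP[e /not_implyP[eV /not_implyP[et hn]]]] := pselect (wise_intersecting t V).
    by left; exists set0; rewrite ?cards0 // setD0.
  right; exists e; split=> // x; rewrite card_gt0; apply/set0Pn; apply: contrapT => h.
  apply: hn; exists x => i ie; apply: contrapT => /negP hi; apply: h.
  by exists i; rewrite inE ie.
have [h|/existsNP[e /not_implyP[eV /not_implyP[et hn]]]] := pselect (wise_intersecting t V).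
  by left; exists set0; rewrite ?cards0 // setD0.
have [[v [ve [K Kk hK]]]|hv] := pselect (exists v, v \in e /\
    exists2 K : {set I}, (#|K| <= k)%N & wise_intersecting t ((V :\ v) :\: K)).
  left; exists (v |: K); last by rewrite -setDDl.
  by rewrite cardsU1; apply: leq_trans (_ : 1 + k <= _)%N; rewrite ?leq_add ?leq_b1.
right.
have [W WP] : exists W : I -> {set I}, forall v, v \in e ->
    [/\ W v \subset V :\ v, (#|W v| <= cover_size t k)%N & forall x, k < miss (W v) x]%N.
  apply: (@functional_choice I {set I} (fun v Wv => v \in e ->
    [/\ Wv \subset V :\ v, (#|Wv| <= cover_size t k)%N & forall x, k < miss Wv x]%N)) => v.
  have [ve|/negP] := boolP (v \in e); last by exists set0.
  have [[K Kk hK]|[Wv hWv]] := IH (V :\ v); last by exists Wv.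
  by case: hv; exists v; split=> //; exists K.
exists (e :|: \bigcup_(v in e) W v); split.
- rewrite subUset eV; apply/bigcupsP => v ve; have [h _ _] := WP v ve.
  by apply: subset_trans h (subsetDl _ _).
- apply: leq_trans (leq_card_setU _ _) _; rewrite leq_add //=.
  apply: leq_trans (leq_card_bigcup (n := cover_size t k) _) _; last by rewrite leq_mul2r et orbT.
  by move=> v ve; have [_ h _] := WP v ve.
move=> x; have [v ve vx] : exists2 v, v \in e & ~~ hit v x.
  apply: contrapT => h; apply: hn; exists x => i ie; apply: contrapT => /negP hi; apply: h.
  by exists i.
have [Wv _ /(_ x) hx] := WP v ve.
have -> : e :|: \bigcup_(v in e) W v = [set v] :|: (e :|: \bigcup_(v in e) W v).
  by rewrite setUA (setUidPr (_ : [set v] \subset e)) ?sub1set.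
apply: (@leq_trans (miss ([set v] :|: W v) x)); last first.
  by apply: miss_subset; apply: setUS; apply: subsetU; rewrite (bigcup_sup v) ?orbT.
rewrite missU; last first.
  rewrite disjoints1; apply/negP => /(subsetP Wv); by rewrite !inE eqxx.
rewrite -[k.+2]add1n leq_add // card_gt0; apply/set0Pn; exists v.
by rewrite !inE eqxx.
Qed.

Lemma min_miss_leq (V S : {set I}) (p k f l : nat) : deficiency_le V p k -> (k + l < p)%N ->
  S \subset V -> (forall x, f <= miss S x)%N -> (#|S| <= f + l)%N ->
  (#|S| <= p)%N /\ (f <= k)%N.
Proof.
move=> dV kp SV hf Sf.
have [Sp|pS] := leqP #|S| p.
  by split=> //; have [x hx] := dV S SV Sp; apply: leq_trans (hf x) hx.
have [W] : exists2 W : {set I}, W \subset S & #|W| = p.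
  have /card_gt0P[W] : (0 < #|[set W : {set I} | W \subset S & #|W| == p]|)%N.
    by rewrite cards_draws bin_gt0 ltnW.
  by rewrite inE => /andP[WS /eqP Wp]; exists W.
move=> WS Wp; have [|x hx] := dV W (subset_trans WS SV); first by rewrite Wp.
have := hf x; rewrite -(setID S W) (setIidPr WS) missU; last first.
  by rewrite disjoint_sym disjoints_subset setDE subsetIr.
have : (miss (S :\: W) x <= #|S :\: W|)%N.
  by apply/subset_leq_card/subsetP => i; rewrite inE => /andP[].
rewrite cardsD (setIidPr WS) Wp; lia.
Qed.

(* Each round removes a large family of pairwise disjoint members, unless few points pierce
   what is left; this shrinks [k - f] by a constant factor and lets [#|S| - f] grow by 1. *)
Lemma peel (V : {set I}) (p k l : nat) (c := (8 * s * s.+1)%N) :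
  deficiency_le V p k -> (k + l < p)%N ->
  pierced V (k + 1)%N \/
  exists (S : {set I}) (f : nat), [/\ S \subset V, exists x, miss S x = f,
    forall x, (f <= miss S x)%N, (#|S| <= f + l)%N &
    (k - f <= 2 * c)%N \/ ((2 * c) ^ l * (k - f) <= (2 * c).-1 ^ l * k)%N].
Proof.
move=> dV; have c0 : (0 < c)%N by rewrite !muln_gt0 s_gt0.
elim: l => [|l IH] kp.
  right; exists set0, 0%N.
  have m0 x : miss set0 x = 0%N by apply: eq_card0 => i; rewrite !inE.
  by split; rewrite ?sub0set ?cards0 //; [exists 0 | right; rewrite !expn0 subn0].
have [|h|] := IH; [lia|by left|move=> [S [f [SV [x0 x0f] hf Sf hk]]]].
have [ke|ke] := leqP (k - f) (2 * c)%N.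
  by right; exists S, f; split=> //; [exists x0|rewrite addnS leqW|left].
have [] := min_miss_leq dV _ SV hf Sf; first lia.
move=> Sp fk.
have [hm|] := pselect (forall S' : {set I}, S' \subset V :\: S -> disjoint_members J S' ->
    #|S'| <= (k - f) %/ c)%N.
  left; have hp := pierced_of_matching Jconvex s_gt0 hit_ex hm.
  apply: pierced_leq (piercedU (B := V :\: S) _ (pierced_miss S x0) hp); last first.
    by apply/subsetP => i iV; rewrite !inE iV andbT orbN.
  by rewrite x0f mulnC -/c; have := leq_divM (k - f) c; lia.
move=> /existsNP[S' /not_implyP[S'V /not_implyP[dS' /negP]]].
rewrite -ltnNge ltn_divLR // => hS'.
have dSS' : [disjoint S & S'] by move: S'V; rewrite subsetD disjoint_sym => /andP[].
have [f' [[x1 x1f'] hf']] := exists_min_miss (S :|: S').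
have hff' : (f + #|S'| <= f'.+1)%N.
  by rewrite -x1f' missU // -addnS leq_add // miss_disjoint_members.
right; exists (S :|: S'), f'; split=> //.
- by rewrite subUset SV (subset_trans S'V) ?subsetDl.
- by exists x1.
- by apply: leq_trans (leq_card_setU _ _) _; lia.
right; case: hk => [|hk]; first by rewrite leqNgt ke.
have step : (2 * c * (k - f') <= (2 * c).-1 * (k - f))%N.
  have m0 : (0 < #|S'|)%N by move: hS'; case: #|S'|.
  have he : (k - f' <= (k - f) - #|S'|.-1)%N by lia.
  move: c0 ke hS' m0 he {IH hk}; rewrite -/c.
  move: (k - f)%N (k - f')%N #|S'| c => e e' m d d0 de em m0 he.
  by have : (2 * (d * m.-1) >= e)%N; nia.
rewrite expnSr -mulnA (leq_trans (leq_mul (leqnn _) step)) // mulnCA expnS -mulnA.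
by rewrite leq_mul.
Qed.

Lemma pierced_of_deficiency_le (V : {set I}) (t p k l : nat) (c := (8 * s * s.+1)%N) :
  (0 < t)%N -> (forall W, wise_intersecting t W -> pierced W s) ->
  (k + l + cover_size t (2 * c) <= p)%N -> ((2 * c).-1 ^ l * k < (2 * c) ^ l)%N ->
  deficiency_le V p k -> pierced V (k + s + 1)%N.
Proof.
move=> t0 ht hp hl dV; have b0 := cover_size_gt0 (2 * c) t0.
have kl : (k + l < p)%N by lia.
have [h|] := peel dV kl; first by apply: pierced_leq h; lia.
move=> [S [f [SV [x0 x0f] hf Sf hk]]].
have [Sp fk] := min_miss_leq dV kl SV hf Sf.
have {}hk : (k - f <= 2 * c)%N.
  case: hk => // h; have := leq_ltn_trans h hl; rewrite -/c -[X in (_ < X)%N]muln1.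
  by rewrite ltn_mul2l => /andP[_]; rewrite ltnS leqn0 => /eqP->.
suff hV : pierced (V :\: S) (k - f + s).
  apply: pierced_leq (piercedU (B := V :\: S) _ (pierced_miss S x0) hV).
    by rewrite x0f; lia.
  by apply/subsetP => i iV; rewrite !inE iV andbT orbN.
have [[K Kk /ht hK]|[W [WV Wc hW]]] := wise_intersecting_or_deficient t (k - f) (V :\: S).
  apply: piercedU (pierced_leq Kk (pierced_card K)) hK.
  by apply/subsetP => i iV; rewrite in_setU in_setD iV andbT orbN.
have [|x hx] := deficiency_le_setD dV SV Sp hf WV.
  by have := leq_cover_size t0 hk; lia.
by have := hW x; rewrite ltnNge hx.
Qed.

End Peeling.

From mathcomp Require Import finmap classical_sets convex interval_inference.
Local Open Scope fset_scope.
Local Open Scope ring_scope.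

Definition fimage (T : finType) (K : choiceType) (f : T -> K) (A : {set T}) : {fset K} :=
  [fset x in [seq f i | i <- enum A]].

Lemma fimageP (T : finType) (K : choiceType) (f : T -> K) (A : {set T}) (x : K) :
  reflect (exists2 i, i \in A & x = f i) (x \in fimage f A).
Proof.
rewrite inE; apply: (iffP mapP) => -[i iA ->]; exists i => //.
  by rewrite mem_enum in iA.
by rewrite mem_enum.
Qed.

Lemma card_fimage (T : finType) (K : choiceType) (f : T -> K) (A : {set T}) :
  {in A &, injective f} -> #|` fimage f A| = #|A|.
Proof.
move=> finj; rewrite card_fseq undup_id ?size_map -?cardE // map_inj_in_uniq ?enum_uniq //.
by move=> i j; rewrite !mem_enum; apply: finj.
Qed.

Lemma exists_fsubset_card (K : choiceType) (A : {fset K}) (n : nat) : (n <= #|` A|)%N ->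
  exists2 B : {fset K}, B `<=` A & #|` B| = n.
Proof.
move=> nA; exists [fset x in take n (enum_fset A)].
  by apply/fsubsetP => x; rewrite inE => /mem_take.
by rewrite card_fseq undup_id ?size_take_min; [apply/minn_idPl | rewrite take_uniq ?fset_uniq].
Qed.

Lemma exists_fsubset_extension (K : choiceType) (P F : {fset K}) (n : nat) :
  P `<=` F -> (#|` P| <= n <= #|` F|)%N ->
  exists P' : {fset K}, [/\ P `<=` P', P' `<=` F & #|` P'| = n].
Proof.
move=> PF /andP[Pn nF].
have cD : #|` F `\` P| = (#|` F| - #|` P|)%N by rewrite cardfsD (fsetIidPr PF).
have [|B BD Bn] := @exists_fsubset_card _ (F `\` P) (n - #|` P|); first by rewrite cD leq_sub2r.
exists (P `|` B); split; first exact: fsubsetUl.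
  by rewrite fsubUset PF (fsubset_trans BD) ?fsubsetDl.
have PB : P `&` B = fset0.
  by apply/eqP/fset0Pn => -[x]; rewrite inE => /andP[xP /(fsubsetP BD)]; rewrite inE xP.
by rewrite cardfsU PB cardfs0 subn0 Bn subnKC.
Qed.

Lemma convex_setR (R : realType) (A : set R) :
  convex_set (A : set R^o) <-> forall x y z, A x -> A z -> x <= y <= z -> A y.
Proof.
have l01 (l : {i01 R}) : 0 <= l%:num <= 1 by rewrite ge0 le1.
have convE (l : {i01 R}) (x z : convex_lmodType R^o) :
  conv l x z = (l%:num * (x : R) + (1 - l%:num) * (z : R)) by [].
split=> [cA x y z Ax Az /andP[xy yz]|hA x z l].
  have [xz|zx] := ltP x z; last by have -> : y = x by lra.
  have d0 : 0 < z - x by lra.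
  have l0 : 0 <= (z - y) / (z - x) by apply: divr_ge0; lra.
  have l1 : (z - y) / (z - x) <= 1 by rewrite ler_pdivrMr //; lra.
  have := cA x z (Itv01 l0 l1); rewrite !inE => /(_ Ax Az).
  congr (A _); rewrite convE /=; field; lra.
rewrite !inE convE => Ax Az; set t := _%:num.
have /andP[t0 t1] : 0 <= t <= 1 := l01 l.
have [xz|/ltW zx] := leP x z; [apply: (hA x _ z)|apply: (hA z _ x)] => //; nra.
Qed.

Lemma s_convexP (R : realType) (s : nat) (A : set R) : s_convex s A ->
  exists K : 'I_s -> R -> bool,
    (forall c x y z, K c x -> K c z -> x <= y <= z -> K c y) /\
    forall x, A x <-> exists c, K c x.
Proof.
move=> [k ks [C [Cc ->]]].
exists (fun c x => `[< exists2 i : 'I_k, i = c :> nat & C i x >]); split.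
  move=> c x y z /asboolP[i ic Cx] /asboolP[j jc Cz] xyz; apply/asboolP; exists i => //.
  have ji : j = i by apply: val_inj; rewrite /= ic jc.
  by rewrite ji in Cz; have /convex_setR := Cc i; apply; first exact: Cx; first exact: Cz.
move=> x; split=> [[i _ Cx]|[c /asboolP[i _ Cx]]]; last by exists i.
by exists (widen_ord ks i); apply/asboolP; exists i.
Qed.

Lemma HD_bound_of_pierced (R : realType) (s p q N : nat) : (q <= p)%N ->
  (forall (I : finType) (J : I -> 'I_s -> R -> bool),
    (forall i c x y z, J i c x -> J i c z -> x <= y <= z -> J i c y) ->
    (forall i, exists x, hit J i x) ->
    deficiency_le J finset.setT p (p - q) -> pierced J finset.setT N) ->
  HD_bound R s p q N.
Proof.
move=> qp H F FP [pF Fpq].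
pose I := fset_sub_type F.
have [J JP] : exists J : I -> 'I_s -> R -> bool, forall i,
    (forall c x y z, J i c x -> J i c z -> x <= y <= z -> J i c y) /\
    forall x, (val i) x <-> exists c, J i c x.
  apply: (@functional_choice I ('I_s -> R -> bool) (fun i K =>
    (forall c x y z, K c x -> K c z -> x <= y <= z -> K c y) /\
    forall x, (val i) x <-> exists c, K c x)) => i; apply: s_convexP; exact: (FP _ (valP i)).2.
have hitP i x : hit J i x <-> (val i) x.
  by have [_ h] := JP i; rewrite h; split=> /existsP.
have hit_ex i : exists x, hit J i x.
  by have [[x hx] _] := FP _ (valP i); exists x; apply/hitP.
have [||X hX XP] := H I J _ hit_ex; first by move=> i; have [h _] := JP i.
  move=> W _ Wp.
  have [||P [WP PF Pp]] := @exists_fsubset_extension _ (fimage val W) F p.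
  - by apply/fsubsetP => _ /fimageP[i _ ->]; apply: valP.
  - by rewrite card_fimage ?Wp // => i j _ _; apply: val_inj.
  have [Q [QP Qq [x Qx]]] := Fpq P PF Pp; exists x.
  rewrite -Pp -Qq -(fsetIidPr QP) -cardfsD.
  rewrite /miss -(card_fimage (f := val)); last by move=> i j _ _; apply: val_inj.
  apply/fsubset_leq_card/fsubsetP => _ /fimageP[i + ->]; rewrite !inE => /andP[iW nx].
  rewrite (fsubsetP WP) ?andbT; last by apply/fimageP; exists i.
  by apply: contra nx => iQ; apply/hitP; apply: Qx.
have ex : exists n, `[< exists2 X, pierces X F & #|` X| = n >].
  exists #|` [fset x in X]|; apply/asboolP; exists [fset x in X] => // A AF.
  have /hasP[x xX /hitP hx] := XP [` AF] (finset.in_setT _); exists x => //.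
  by rewrite inE.
exists (ex_minn ex); case: ex_minnP => n /asboolP nP hmin.
  by split=> // m mP; apply: hmin; apply/asboolP.
apply: leq_trans hX; apply: leq_trans (_ : #|` [fset x in X]| <= _)%N; last first.
  by rewrite card_fseq size_undup.
apply: hmin; apply/asboolP; exists [fset x in X] => // A AF.
have /hasP[x xX /hitP hx] := XP [` AF] (finset.in_setT _); exists x => //.
by rewrite inE.
Qed.

Lemma HD_bound_diag (R : realType) (s t u N : nat) : (t <= u)%N ->
  HD_bound R s t t N -> HD_bound R s u u N.
Proof.
move=> tu H F FP [uF Fuu]; apply: (H F FP); split; first exact: leq_trans uF.
move=> P PF Pt.
have [|P' [PP' P'F P'u]] := @exists_fsubset_extension _ P F u PF; first by rewrite Pt tu.
have [Q [QP' Qu [x Qx]]] := Fuu P' P'F P'u.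
have QE : Q = P' by apply/eqP; rewrite eqEfcard QP' Qu P'u leqnn.
by exists P; split=> //; exists x => A AP; apply: Qx; rewrite QE (fsubsetP PP').
Qed.

Lemma HD_bound_22 (R : realType) (s : nat) : (0 < s)%N -> HD_bound R s 2 2 (8 * s * s.+1).
Proof.
move=> s0; apply: HD_bound_of_pierced => // I J Jc Jex dJ; rewrite -[(8 * s * _)%N]muln1.
apply: pierced_of_matching => // S _ dS; apply/card_le1_eqP => i j iS jS.
apply/esym/dS => //.
have [||x] := dJ [set i; j]; first exact: finset.subsetT.
  by apply: leq_trans (leq_card_setU _ _) _; rewrite !cards1.
rewrite subnn leqn0 cards_eq0 => /eqP/setP m; apply/asboolP; exists x.
have := m i; have := m j; rewrite !inE !eqxx orbT /= => /negbFE-> /negbFE->.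
by [].
Qed.

Lemma exists_linear_expr_lt (R : realType) (a : nat) (y : R) : 0 < y < 1 ->
  exists n, (n.+1 * a)%:R * y ^+ n < 1.
Proof.
case/andP=> y0 y1.
have d0 : 0 < y^-1 - 1 by rewrite subr_gt0 invf_gt1.
set d := y^-1 - 1 in d0.
have h0 : 0 <= (3 * a)%:R / d ^+ 2 by rewrite divr_ge0 // sqr_ge0.
have := archi_boundP h0; set m := Num.bound _ => hm; exists (m * 2)%N.
have m1 : 1 <= m%:R :> R by rewrite ler1n -(ltr0n R) (le_lt_trans h0).
rewrite ltr_pdivrMr ?exprn_gt0 // natrM in hm.
have dE : 1 + d = y^-1 by rewrite /d addrC subrK.
have := bernoulli m (ltW d0); rewrite dE exprVn -[X in _ <= X]div1r.
have z0 : 0 < y ^+ m by rewrite exprn_gt0.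
rewrite ler_pdivlMr // exprM; set z := y ^+ m in z0 * => hz.
have md0 : 0 <= m%:R * d by rewrite mulr_ge0 // ltW.
have hz2 : (m%:R * d * z) ^+ 2 <= 1 by apply: exprn_ile1; nra.
apply: lt_le_trans hz2.
rewrite exprMn ltr_pM2r ?exprn_gt0 // natrM -natr1 natrM.
apply: (@le_lt_trans _ _ (m%:R * (3 * a%:R))); first by have : 0 <= a%:R :> R by []; nra.
by rewrite exprMn expr2 -mulrA ltr_pM2l; lra.
Qed.

Lemma exists_wise_intersecting_pierced (R : realType) (s : nat) : (0 < s)%N ->
  exists2 t, (1 < t)%N &
  forall (I : finType) (J : I -> 'I_s -> R -> bool),
  (forall i c x y z, J i c x -> J i c z -> x <= y <= z -> J i c y) ->
  forall V, wise_intersecting J t V -> pierced J V s.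
Proof.
move=> s0; set e : R := (2 ^ s.+1)%:R^-1.
have e0 : 0 < e by rewrite invr_gt0 ltr0n expn_gt0.
have e1 : e < 1 by rewrite invf_lt1 ?ltr0n ?expn_gt0 // ltr1n -{1}(expn0 2) ltn_exp2l.
have [|n hn] := @exists_linear_expr_lt R s (1 - e); first by apply/andP; split; lra.
case: n hn => [|n hn].
  by rewrite expr0 mulr1 mul1n ltrn1 ltnNge s0.
exists n.+2 => // I J Jc V; exact: pierced_of_wise_intersecting.
Qed.

Lemma HD_bound_diag_of_wise (R : realType) (s t : nat) :
  (forall (I : finType) (J : I -> 'I_s -> R -> bool),
    (forall i c x y z, J i c x -> J i c z -> x <= y <= z -> J i c y) ->
    forall V, wise_intersecting J t V -> pierced J V s) ->
  HD_bound R s t t s.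
Proof.
move=> ht; apply: HD_bound_of_pierced => // I J Jc _ dJ; apply: ht => // W WV Wt.
have [x] := dJ W WV Wt; rewrite subnn leqn0 cards_eq0 => /eqP/setP m.
exists x => i iW; have := m i; rewrite !inE iW /= => /negbFE.
by [].
Qed.

Lemma exists_log_rounds (R : realType) (K p k : nat) : (0 < K)%N -> (0 < p)%N -> (k < p)%N ->
  exists2 l : nat, (K.-1 ^ l * k < K ^ l)%N & l%:R <= K%:R * ln p%:R + 1 :> R.
Proof.
move=> K0 p0 kp; have p1 : 1 <= p%:R :> R by rewrite ler1n.
have ln0 : 0 <= K%:R * ln p%:R :> R by rewrite mulr_ge0 // ln_ge0.
have K0R : 0 < K%:R :> R by rewrite ltr0n.
have /andP[h1 h2] := truncn_itv ln0; set l := Num.truncn _ in h1 h2.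
exists l.+1; last by rewrite -natr1 lerD2r.
rewrite -(ltr_nat R) natrM !natrX.
have KE : K.-1%:R = K%:R * (1 - K%:R^-1) :> R.
  by rewrite mulrBr mulfV ?gt_eqF // mulr1 -subn1 natrB.
rewrite KE exprMn -mulrA -[X in _ < X]mulr1 ltr_pM2l ?exprn_gt0 //.
have p0R : 0 < p%:R :> R by rewrite ltr0n.
apply: (@le_lt_trans _ _ (p%:R^-1 * k%:R)); last first.
  by rewrite mulrC ltr_pdivrMr // mul1r ltr_nat.
rewrite ler_wpM2r //.
apply: (@le_trans _ _ (expR (- K%:R^-1) ^+ l.+1)).
  rewrite ler_pXn2r ?nnegrE ?expR_ge0 ?expR_ge1Dx // subr_ge0 invf_le1 // ler1n //.
rewrite -expRM_natl -[X in _ <= X]lnK ?posrE ?invr_gt0 // ler_expR lnV ?posrE //.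
rewrite mulrN lerN2 ler_pdivlMr // mulrC; exact: ltW.
Qed.

Lemma HD_bound_large (R : realType) (s : nat) : (0 < s)%N -> exists2 C : R, 0 < C &
  forall p q : nat, (1 <= p)%N -> C * ln (expR 1 * p%:R) <= q%:R -> (q <= p)%N ->
    HD_bound R s p q (p - q + s + 1) /\ (0 < q)%N.
Proof.
move=> s0; have [t t1 ht] := exists_wise_intersecting_pierced R s0.
pose K := (2 * (8 * s * s.+1))%N; have K0 : (0 < K)%N by rewrite !muln_gt0 s0.
pose b := cover_size t K.
exists (K + b + 2)%:R => [|p q p1 hq qp]; first by rewrite ltr0n addn2.
have p1R : 1 <= p%:R :> R by rewrite ler1n.
have ln0 : 0 <= ln p%:R :> R by rewrite ln_ge0.
rewrite lnM ?posrE ?expR_gt0 ?ltr0n // expRK in hq.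
have [Kn0 bn0] : 0 <= K%:R :> R /\ 0 <= b%:R :> R by [].
rewrite (natrD _ (K + b)) (natrD _ K) in hq.
have hq' : K%:R * ln p%:R + b%:R + 2 <= q%:R :> R.
  by have := mulr_ge0 bn0 ln0; move: hq; lra.
have q0 : (0 < q)%N by rewrite -(ltr0n R); have := mulr_ge0 Kn0 ln0; lra.
split=> //; have kp : (p - q < p)%N by lia.
have [l hl lle] := exists_log_rounds R K0 p1 kp.
have lb : (l + b <= q)%N by rewrite -(ler_nat R) natrD; lra.
apply: HD_bound_of_pierced => // I J Jc Jex dJ.
by apply: (pierced_of_deficiency_le Jc s0 Jex _ (ht I J Jc) _ hl dJ); [lia|rewrite -/K -/b; lia].
Qed.

Section LowerBound.
Variables (R : realType) (s p q : nat).
Hypotheses (s_gt1 : (1 < s)%N) (q_gt0 : (0 < q)%N) (qp : (q <= p)%N).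
Local Notation M := (q * s)%N.

Definition cell (m : nat) (x : R) := m%:R <= x < m.+1%:R.

Lemma cell_inj (m n : nat) (x : R) : cell m x -> cell n x -> m = n.
Proof.
move=> /andP[h1 h2] /andP[h3 h4].
have := le_lt_trans h1 h4; have := le_lt_trans h3 h2; rewrite !ltr_nat; lia.
Qed.

Lemma cell_nat (m : nat) : cell m m%:R.
Proof. by rewrite /cell lexx ltr_nat ltnSn. Qed.

Lemma cell_leq (m n : nat) (x y : R) : cell m x -> cell n y -> x <= y -> (m <= n)%N.
Proof.
move=> /andP[h1 h2] /andP[h3 h4] xy.
by have := le_lt_trans (le_trans h1 xy) h4; rewrite ltr_nat ltnS.
Qed.

Definition cells_but (Y : {set 'I_M}) : set R :=
  fun x => exists2 m : 'I_M, m \notin Y & cell m x.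

Lemma s_convex_cells_but (Y : {set 'I_M}) : (#|Y| < s)%N -> s_convex s (cells_but Y).
Proof.
move=> Ys; exists s => //.
pose below (m : nat) := #|[set i in Y | (i < m)%N]%SET|.
have below_leq m n : (m <= n)%N -> (below m <= below n)%N.
  move=> mn; apply/subset_leq_card/fintype.subsetP => i; rewrite !inE => /andP[-> im] /=.
  exact: leq_trans mn.
exists (fun c : 'I_s => (fun x => exists2 m : 'I_M, m \notin Y & below m = c /\ cell m x) : set R).
split.
  move=> c; apply/convex_setR => x y z [m mY [mc mx]] [n nY [nc nz]] /andP[xy yz].
  have y0 : 0 <= y by apply: le_trans xy; apply: le_trans (_ : m%:R <= x) => //; case/andP: mx.
  have yk := truncn_itv y0; set k := Num.truncn y in yk.
  have mk := cell_leq mx yk xy; have kn := cell_leq yk nz yz.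
  have kM := leq_ltn_trans kn (ltn_ord n).
  exists (Ordinal kM); last first.
    by split=> //=; apply/eqP; rewrite eqn_leq -{1}nc -mc !below_leq.
  apply/negP => kY; have := nc; rewrite -mc; apply/eqP; rewrite gtn_eqF //.
  have kn' : (k < n)%N.
    rewrite ltn_neqAle kn andbT; apply: contra nY => /eqP h.
    by rewrite -(_ : Ordinal kM = n) //; apply: val_inj.
  apply: proper_card; apply/properP; split.
    apply/fintype.subsetP => i; rewrite !inE => /andP[-> im] /=.
    exact: leq_trans (leq_trans im mk) kn.
  by exists (Ordinal kM); rewrite !inE kY //= -leqNgt.
apply/seteqP; split=> x /=.
  move=> [m mY mx].
  have hc : (below m < s)%N.
    by apply: leq_ltn_trans Ys; apply/subset_leq_card/fintype.subsetP => i; rewrite inE => /andP[].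
  by exists (Ordinal hc) => //; exists m.
by move=> [c _ [m mY [_ mx]]]; exists m.
Qed.

Lemma HD_bound_lower (N : nat) : HD_bound R s p q N -> (p - q + s <= N)%N.
Proof.
move=> HN; rewrite leqNgt; apply/negP => Nlt.
pose G : {fset set R} := fimage cells_but [set Y : {set 'I_M} | (#|Y| < s)%N]%SET.
pose pt (j : nat) : R := - j.+1%:R.
pose P0 : {fset set R} := fimage (fun j : 'I_(p - q) => [set pt j]%classic) [set: 'I_(p - q)]%SET.
have pt_lt0 j : pt j < 0 by rewrite oppr_lt0 ltr0n.
have pt_inj : injective pt by move=> i j /oppr_inj/eqP; rewrite eqr_nat eqSS => /eqP.
have cell_ge0 m x : cell m x -> 0 <= x by case/andP=> h _; apply: le_trans h.
have common (Ys : {set {set 'I_M}}) : (#|Ys| <= q)%N -> (forall Y, Y \in Ys -> (#|Y| < s)%N) ->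
    exists m : 'I_M, forall Y, Y \in Ys -> m \notin Y.
  move=> Ysq Yss; apply: contrapT => h.
  have : (#|(\bigcup_(Y in Ys) Y)%SET| <= q * s.-1)%N.
    apply: leq_trans (leq_card_bigcup (B := fun Y => Y) (n := s.-1) _) _; last first.
      by rewrite leq_mul2r Ysq orbT.
    by move=> Y /Yss Ys'; rewrite -ltnS prednK // ltnW.
  have -> : (\bigcup_(Y in Ys) Y = [set: 'I_M])%SET.
    apply/finset.setP => m; rewrite finset.in_setT; apply: contrapT => /negP hm; apply: h.
    by exists m => Y hY; apply: contra hm => mY; apply/bigcupP; exists Y.
  rewrite cardsT card_ord leq_pmul2l //; lia.
have GP A : A \in G -> exists2 Y : {set 'I_M}, (#|Y| < s)%N & A = cells_but Y.
  by move=> /fimageP[Y]; rewrite inE => Ys ->; exists Y.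
have FP A : A \in G `|` P0 -> (A !=set0)%classic /\ s_convex s A.
  rewrite inE => /orP[/GP[Y Ys ->]|/fimageP[j _ ->]].
    split; last exact: s_convex_cells_but.
    have [|Y'|m hm] := common [set Y]%SET; first by rewrite cards1.
      by move=> /finset.set1P->.
    by exists m%:R; exists m; [apply: hm; apply/finset.set1P|exact: cell_nat].
  split; first by exists (pt j).
  exists 1%N; first exact: ltnW.
  exists (fun=> [set pt j]%classic); split=> [_|].
    apply/convex_setR => x y z -> -> /andP[h1 h2]; apply/eqP; by rewrite eq_le h2 h1.
  by apply/seteqP; split=> x /=; [move=> ->; exists ord0 | move=> [_ _]].
have Gq : (q <= #|` G|)%N.
  have inj : injective (fun m : 'I_M => cells_but [set m]%SET).
    move=> m n mn; apply: contrapT => /eqP nm.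
    have : cells_but [set n]%SET m%:R by exists m; [apply/finset.set1P/eqP|exact: cell_nat].
    rewrite -mn => -[k km /cell_inj/(_ (cell_nat m)) kE].
    by move: km; rewrite (_ : k = m) ?finset.set11 //; apply: val_inj.
  apply: (@leq_trans #|` fimage (fun m : 'I_M => cells_but [set m]%SET) [set: 'I_M]%SET|).
    by rewrite card_fimage ?cardsT ?card_ord ?leq_pmulr // ?(ltnW s_gt1) // => i j _ _ /inj.
  apply/fsubset_leq_card/fsubsetP => _ /fimageP[m _ ->]; apply/fimageP.
  by exists [set m]%SET => //; rewrite inE cards1.
have P0c : #|` P0| = (p - q)%N.
  rewrite card_fimage ?cardsT ?card_ord // => i j _ _ h.
  apply/val_inj/pt_inj; have : [set pt i]%classic (pt i) by [].
  by rewrite h.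
have GP0 : G `&` P0 = fset0.
  apply/eqP/fset0Pn => -[A]; rewrite inE => /andP[/GP[Y _ ->] /fimageP[j _ h]].
  have : [set pt j]%classic (pt j) by [].
  by rewrite -h => -[m _ /cell_ge0]; rewrite leNgt pt_lt0.
have pqF : pq_property p q (G `|` P0).
  split; first by rewrite cardfsU GP0 cardfs0 subn0 P0c; lia.
  move=> P PF Pp.
  have PG : (q <= #|` P `&` G|)%N.
    have : (#|` P `\` G| <= p - q)%N.
      rewrite -P0c; apply/fsubset_leq_card/fsubsetP => A; rewrite inE => /andP[AG /(fsubsetP PF)].
      by rewrite inE (negbTE AG).
    have := cardfsID G P; rewrite Pp; lia.
  have [Q QPG Qq] := exists_fsubset_card PG.
  have QG A : A \in Q -> A \in G by move=> /(fsubsetP QPG); rewrite inE => /andP[].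
  exists Q; split=> //; first by apply: fsubset_trans QPG (fsubsetIl _ _).
  have [Y YP] : exists Y : Q -> {set 'I_M}, forall A, (#|Y A| < s)%N /\ val A = cells_but (Y A).
    apply: (@functional_choice Q {set 'I_M} (fun A Y => (#|Y| < s)%N /\ val A = cells_but Y)) => A.
    by have [Y Ys AE] := GP _ (QG _ (valP A)); exists Y.
  have [||m hm] := common (Y @: [set: Q]%SET).
  - by apply: leq_trans (leq_imset_card _ _) _; rewrite cardsT -cardfE Qq.
  - by move=> _ /imsetP[A _ ->]; case: (YP A).
  exists m%:R => A AQ; have [_ /= ->] := YP [` AQ]; exists m; last exact: cell_nat.
  by apply: hm; apply: imset_f.
have [t [[X XF Xt] _] tN] := HN _ FP pqF.
pose Xn := [fset x in X | x < 0]; pose Xp := [fset x in X | 0 <= x].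
have Xsum : (#|` Xn| + #|` Xp| <= #|` X|)%N.
  have d : Xn `&` Xp = fset0.
    by apply/eqP/fset0Pn => -[x]; rewrite !inE /= => /andP[/andP[_ h] /andP[_]]; rewrite leNgt h.
  have := cardfsU Xn Xp; rewrite d cardfs0 subn0 => <-.
  by apply/fsubset_leq_card/fsubsetP => x; rewrite !inE /= => /orP[] /andP[].
have Xnc : (p - q <= #|` Xn|)%N.
  rewrite -[(p - q)%N]card_ord -cardsT -(card_fimage (f := fun j : 'I_(p - q) => pt j)); last first.
    by move=> i j _ _ /pt_inj/val_inj.
  apply/fsubset_leq_card/fsubsetP => _ /fimageP[j _ ->]; rewrite !inE /= pt_lt0 andbT.
  have [|x xX <-] := XF [set pt j]%classic; last by [].
  by rewrite inE; apply/orP; right; apply/fimageP; exists j.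
pose Y := [set m : 'I_M | `[< exists2 x, x \in Xp & cell m x >]]%SET.
have Yc : (#|Y| <= #|` Xp|)%N.
  have [g gP] : exists g : 'I_M -> R, forall m, m \in Y -> g m \in Xp /\ cell m (g m).
    apply: (@functional_choice 'I_M R (fun m x => m \in Y -> x \in Xp /\ cell m x)) => m.
    have [|_] := boolP (m \in Y); last by exists 0.
    by rewrite inE => /asboolP[x xX mx]; exists x.
  rewrite -(card_fimage (f := g)).
    by apply/fsubset_leq_card/fsubsetP => _ /fimageP[m /gP[h _] ->].
  move=> m n /gP[_ hm] /gP[_ hn] e; apply/val_inj; apply: cell_inj hm _; rewrite e.
  exact: hn.
have Ys : (#|Y| < s)%N by lia.
have [|x xX [m mY mx]] := XF (cells_but Y).
  by rewrite inE; apply/orP; left; apply/fimageP; exists Y => //; rewrite inE.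
move: mY; rewrite inE => /asboolP; apply; exists x => //.
by rewrite !inE /= xX (cell_ge0 m).
Qed.

End LowerBound.

Lemma exists_is_HD (R : realType) (s p q N : nat) : HD_bound R s p q N ->
  exists2 m, is_HD R s p q m & (m <= N)%N.
Proof.
move=> HN; have ex : exists n, `[< HD_bound R s p q n >] by exists N; apply/asboolP.
exists (ex_minn ex); case: ex_minnP => n /asboolP nP hmin; last exact/hmin/asboolP.
by split=> // m mP; apply/hmin/asboolP.
Qed.

Theorem theorem1p7 (R : realType) (s : nat) (hs : (2 <= s)%N) :
  exists (kappa : nat) (C : R) (p0 : nat),
    [/\ (s <= kappa <= 2 * s)%N, 0 < C,
      forall p q : nat, (p0 <= p)%N ->
        C * ln (expR 1 * p%:R) <= q%:R -> (q <= p)%N ->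
        exists2 N : nat, is_HD R s p q N &
          (N = p - q + kappa \/ N = p - q + kappa + 1)%N
    & exists h : nat -> nat,
        [/\ forall t : nat, (2 <= t)%N -> is_HD R s t t (h t),
            forall t u : nat, (2 <= t)%N -> (t <= u)%N -> (h u <= h t)%N
          & exists t0 : nat, forall t : nat, (t0 <= t)%N -> h t = kappa]].
Proof.
have s0 : (0 < s)%N by apply: ltnW.
have [t t1 /HD_bound_diag_of_wise HDt] := exists_wise_intersecting_pierced R s0.
have [C C0 hC] := HD_bound_large R s0.
exists s, C, 1%N; split=> //.
- by rewrite leqnn leq_pmull.
- move=> p q p1 hq qp; have [HN q0] := hC p q p1 hq qp.
  have [N NHD Nle] := exists_is_HD HN; exists N => //.
  by have := HD_bound_lower hs q0 qp NHD.1; lia.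
have [h hP] : exists h : nat -> nat, forall t, (2 <= t)%N -> is_HD R s t t (h t).
  apply: (@functional_choice nat nat (fun t m => (2 <= t)%N -> is_HD R s t t m)) => u.
  have [u2|_] := boolP (2 <= u)%N; last by exists 0%N.
  by have [m hm _] := exists_is_HD (HD_bound_diag u2 (@HD_bound_22 R s s0)); exists m.
exists h; split=> // [u v u2 uv|].
  have [_ hmin] := hP v (leq_trans u2 uv).
  by have := hmin _ (HD_bound_diag uv (hP u u2).1).
exists t => u tu; have u2 := leq_trans t1 tu; apply/eqP; rewrite eqn_leq.
have := HD_bound_lower hs (ltnW u2) (leqnn u) (hP u u2).1.
rewrite subnn add0n => ->; rewrite andbT.
by have := (hP u u2).2 _ (HD_bound_diag tu HDt).
Qed.
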